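(* Let $\mathcal{A}$ be a $5$-dimensional complex naturally graded $2$-filiform non-split associative algebra of type $\mu(1,2)$. Then $\mathcal{A}$ is isomorphic to one of the following pairwise non-isomorphic algebras with basis $\{e_1,\dots,e_5\}$ (omitted products of basis elements vanish): \[\lambda_1:\left\{\begin{array}{l} e_1e_1=e_2,\\ e_1e_2=e_2e_1=e_3,\\ e_4e_1=e_5;\end{array}\right. \qquad \lambda_2:\left\{\begin{array}{l} e_1e_1=e_2,\\ e_1e_2=e_2e_1=e_3,\\ e_4e_1=e_5,\\ e_4e_2=e_5e_1=e_3. \end{array}\right.\]
   Context: Associative algebras are not assumed to be unital. For an algebra $\mathcal{A}$ put $\mathcal{A}^1=\mathcal{A}$ and $\mathcal{A}^{i+1}=\sum_{k=1}^{i}\mathcal{A}^k\mathcal{A}^{i+1-k}$ for $i\ge 1$ (linear spans of products); $\mathcal{A}$ is nilpotent if $\mathcal{A}^i=0$ for some $i$. All algebras considered here are nilpotent. For a nilpotent associative algebra $\mathcal{A}$ put $\mathcal{A}_i=\mathcal{A}^i/\mathcal{A}^{i+1}$ and $\operatorname{gr}\mathcal{A}=\bigoplus_{i\ge 1}\mathcal{A}_i$, a graded algebra with the induced product $\mathcal{A}_i\mathcal{A}_j\subseteq\mathcal{A}_{i+j}$. $\mathcal{A}$ is called naturally graded if $\operatorname{gr}\mathcal{A}\cong\mathcal{A}$ as algebras; in that case $\mathcal{A}$ is identified with $\operatorname{gr}\mathcal{A}=\bigoplus_i\mathcal{A}_i$. For $x\in\mathcal{A}\setminus\mathcal{A}^2$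 let $L_x:\mathcal{A}\to\mathcal{A}$, $z\mapsto xz$, and let $C(x)=(n_1,n_2,\dots,n_k)$ be the decreasing sequence of sizes of the Jordan blocks of the nilpotent operator $L_x$. Such sequences are ordered lexicographically. The characteristic sequence of $\mathcal{A}$ is $C(\mathcal{A})=\max_{x\in\mathcal{A}\setminus\mathcal{A}^2}C(x)$. An $n$-dimensional algebra $\mathcal{A}$ is $2$-filiform if $C(\mathcal{A})=(n-2,1,1)$. A naturally graded $2$-filiform algebra $\mathcal{A}=\bigoplus_i\mathcal{A}_i$ of dimension $n$ is said to be of type $\mu(t_1,t_2)$, with $1\le t_1\le t_2$, if it has a homogeneous basis $\{e_1,\dots,e_{n-2},f_1,f_2\}$ with $e_i\in\mathcal{A}_i$ for $1\le i\le n-2$, $f_1\in\mathcal{A}_{t_1}$, $f_2\in\mathcal{A}_{t_2}$, such that $e_ie_j=e_{i+j}$ for $i,j\ge1$, $2\le i+j\le n-2$, $e_ie_j=0$ for $i+j>n-2$, and $e_kf_s=0$ for $1\le k\le n-2$, $1\le s\le 2$. Non-split means not isomorphic to a direct sum of two nonzero algebras (ideals). *)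

(* Defs.v *)
From HB Require Import structures.
From mathcomp Require Import all_boot all_order all_algebra.
From mathcomp Require Import reals.
From mathcomp Require Import complex.
From mathcomp Require Import zify.

Set Implicit Arguments.
Unset Strict Implicit.
Unset Printing Implicit Defensive.

Import Order.TTheory GRing.Theory.

Local Open Scope ring_scope.

(** Finite-dimensional associative algebras, not assumed to be unital (hence
    not an instance of [algType]). *)

HB.mixin Record Vector_isAssocAlg (K : fieldType) A of Vector K A := {
  amul : A -> A -> A;
  amulA : associative amul;
  amul_linearl : forall y : A, linear (amul^~ y);
  amul_linearr : forall x : A, linear (amul x)
}.

#[short(type="assocAlgType")]
HB.structure Definition AssocAlg (K : fieldType) :=
  {A of Vector_isAssocAlg K A & Vector K A}.

Declare Scope assoc_alg_scope.
Delimit Scope assoc_alg_scope with AA.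
Notation "x ** y" := (amul x y) (at level 40, left associativity)
  : assoc_alg_scope.
Local Open Scope assoc_alg_scope.

Section Bilinearity.
Variables (K : fieldType) (A : assocAlgType K).

HB.instance Definition _ (x : A) :=
  GRing.isLinear.Build K A A *:%R (amul x) (amul_linearr x).

Definition amulr (y x : A) := x ** y.

HB.instance Definition _ (y : A) :=
  GRing.isLinear.Build K A A *:%R (amulr y) (amul_linearl y).

Lemma amul0l (y : A) : 0 ** y = 0.
Proof. exact: (raddf0 (amulr y)). Qed.
Lemma amul0r (x : A) : x ** 0 = 0.
Proof. exact: raddf0. Qed.
Lemma amulBl (x x' y : A) : (x - x') ** y = x ** y - x' ** y.
Proof. exact: (raddfB (amulr y)). Qed.
Lemma amulBr (x y y' : A) : x ** (y - y') = x ** y - x ** y'.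
Proof. exact: raddfB. Qed.
Lemma amulDl (x x' y : A) : (x + x') ** y = x ** y + x' ** y.
Proof. exact: (raddfD (amulr y)). Qed.
Lemma amulDr (x y y' : A) : x ** (y + y') = x ** y + x ** y'.
Proof. exact: raddfD. Qed.
Lemma amulZl a (x y : A) : (a *: x) ** y = a *: (x ** y).
Proof. exact: (linearZ_LR (amulr y)). Qed.
Lemma amulZr a (x y : A) : x ** (a *: y) = a *: (x ** y).
Proof. exact: linearZ_LR. Qed.
Lemma amul_suml I r (P : pred I) (F : I -> A) (y : A) :
  (\sum_(i <- r | P i) F i) ** y = \sum_(i <- r | P i) F i ** y.
Proof. exact: (raddf_sum (amulr y)). Qed.
Lemma amul_sumr I r (P : pred I) (F : I -> A) (x : A) :
  x ** (\sum_(i <- r | P i) F i) = \sum_(i <- r | P i) x ** F i.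
Proof. exact: raddf_sum. Qed.

End Bilinearity.

Definition alg_iso (K : fieldType) (A B : assocAlgType K) : Prop :=
  exists phi : {linear A -> B},
    bijective phi /\ forall x y : A, phi (x ** y) = phi x ** phi y.

Section DirectSum.
Variables (K : fieldType) (B C : assocAlgType K).

Definition pair_mul (x y : B * C) : B * C := (x.1 ** y.1, x.2 ** y.2).

Fact pair_mulA : associative pair_mul.
Proof. by move=> x y z; rewrite /pair_mul /= !amulA. Qed.

Fact pair_mul_linearl y : linear (pair_mul^~ y).
Proof. by move=> a x x'; rewrite /pair_mul /= !amulDl !amulZl. Qed.

Fact pair_mul_linearr x : linear (pair_mul x).
Proof. by move=> a y y'; rewrite /pair_mul /= !amulDr !amulZr. Qed.

HB.instance Definition _ :=
  Vector_isAssocAlg.Build K (B * C)%type pair_mulA pair_mul_linearl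
    pair_mul_linearr.
End DirectSum.

Definition split_alg (K : fieldType) (A : assocAlgType K) : Prop :=
  exists B C : assocAlgType K,
    [/\ \dim {:B} != 0, \dim {:C} != 0 & alg_iso A (B * C)%type].

Section Powers.
Variables (K : fieldType) (A : assocAlgType K).
Implicit Types U V W : {vspace A}.

(* linear span of the products, as [prodv] for unital algebras *)
Definition mulv U V : {vspace A} :=
  <<[seq u ** v | u <- vbasis U, v <- vbasis V]>>%VS.

Lemma memv_mulv U V x y : x \in U -> y \in V -> x ** y \in mulv U V.
Proof.
move=> /coord_vbasis -> /coord_vbasis ->.
rewrite amul_suml memv_suml // => i _; rewrite amul_sumr memv_suml // => j _.
rewrite amulZl amulZr !memvZ // memv_span //.
by apply: allpairs_f; rewrite mem_nth // size_tuple.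
Qed.

Lemma mulvP U V W :
  reflect (forall x y, x \in U -> y \in V -> x ** y \in W)
          (mulv U V <= W)%VS.
Proof.
apply: (iffP idP) => [sUVW x y Ux Vy | sUVW].
  by apply: (subvP sUVW); apply: memv_mulv.
apply/span_subvP => _ /allpairsP[[x y] /= [Ux Vy ->]].
by apply: sUVW; apply: vbasis_mem.
Qed.

Lemma mulvS U U' V V' :
  (U <= U')%VS -> (V <= V')%VS -> (mulv U V <= mulv U' V')%VS.
Proof.
move=> /subvP sU /subvP sV; apply/mulvP => x y Ux Vy.
by rewrite memv_mulv ?sU ?sV.
Qed.

(* [apows i] lists A^1, ..., A^i, so that entry k is A^(k+1) *)
Fixpoint apows (i : nat) : seq {vspace A} :=
  if i isn't j.+1 then [::] else
  rcons (apows j)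
    (if j == 0%N then fullv
     else \sum_(k < j) mulv (nth 0%VS (apows j) k)
                            (nth 0%VS (apows j) (j.-1 - k)))%VS.

(* A^i for i >= 1; see [apow1] and [apowS] for the recursion.  The value at 0
   is irrelevant. *)
Definition apow (i : nat) : {vspace A} := nth 0%VS (apows i) i.-1.

Lemma size_apows i : size (apows i) = i.
Proof. by elim: i => //= i IHi; rewrite size_rcons IHi. Qed.

Lemma nth_apows i k : (k < i)%N -> nth 0%VS (apows i) k = apow k.+1.
Proof.
elim: i => // i IHi; rewrite ltnS leq_eqVlt => /predU1P[-> // | lt_ki].
by rewrite /= nth_rcons size_apows lt_ki IHi.
Qed.

Lemma apow1 : apow 1 = fullv. Proof. by []. Qed.

Lemma apowS i : (0 < i)%N ->
  apow i.+1 = (\sum_(1 <= k < i.+1) mulv (apow k) (apow (i.+1 - k)))%VS.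
Proof.
case: i => // i _.
rewrite {1}/apow [apows i.+2]/= nth_rcons size_rcons size_apows /= ltnn eqxx.
rewrite big_add1 big_mkord; apply: eq_bigr => k _.
have le_ki : (k <= i)%N by exact: (ltn_ord k).
rewrite -[rcons _ _]/(apows i.+1) !nth_apows ?ltnS ?leq_subr //=.
by rewrite subSS subSn.
Qed.

Lemma apow_mul i j : (0 < i)%N -> (0 < j)%N ->
  (mulv (apow i) (apow j) <= apow (i + j))%VS.
Proof.
case: i => // i _; case: j => // j _; rewrite addSn addnS.
rewrite [apow (i + j).+2]apowS // big_add1 big_mkord.
have lt_i : (i < (i + j).+1)%N by rewrite ltnS leq_addr.
apply: (sumv_sup (Ordinal lt_i)) => //=.
by rewrite subSS -addnS addKn.
Qed.

Lemma memv_apowM i j x y : (0 < i)%N -> (0 < j)%N ->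
  x \in apow i -> y \in apow j -> x ** y \in apow (i + j).
Proof. by move=> i0 j0 Ax Ay; apply/(subvP (apow_mul i0 j0))/memv_mulv. Qed.

Lemma apow_sub i : (0 < i)%N -> (apow i.+1 <= apow i)%VS.
Proof.
elim/ltn_ind: i => -[// | [_ _|i IHi _]]; first by rewrite apow1 subvf.
rewrite [apow i.+3]apowS // big_add1 big_mkord; apply/subv_sumP => k _.
case: k => -[|k] /= lt_k; rewrite subSS.
  rewrite subn0; apply: subv_trans (apow_mul (isT : 0 < 1)%N (ltn0Sn i)).
  by rewrite mulvS // IHi.
have e : (k.+1 + (i.+2 - k.+1) = i.+2)%N by rewrite subnKC // ltnW.
rewrite -[X in (_ <= apow X)%VS]e.
apply: subv_trans (mulvS (IHi k.+1 lt_k isT) (subvv _)) _.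
by rewrite apow_mul // subn_gt0.
Qed.

Definition nilpotent : Prop := exists2 i, (0 < i)%N & apow i = 0%VS.

End Powers.

(* For W <= U, the quotient U / W, realized on the library's complement
   [U :\: W] of W in U; [qclass] is only meaningful on U, where it is linear,
   onto, and has kernel W. *)
Section Quotient.
Variables (K : fieldType) (vT : vectType K).
Implicit Types U W : {vspace vT}.

Definition quotv U W := subvs_of (U :\: W)%VS.

HB.instance Definition _ U W := Vector.on (quotv U W).

Definition qrepr U W (q : quotv U W) : vT := vsval q.

HB.instance Definition _ U W :=
  GRing.isLinear.Build K (quotv U W) vT *:%R (@qrepr U W)
    (linearP (vsval : subvs_of (U :\: W)%VS -> vT)).

Definition qclass U W (x : vT) : quotv U W :=
  vsproj (U :\: W)%VS (addv_pi1 U W x).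

Fact qclass_linear U W : linear (@qclass U W).
Proof. by move=> a x y; rewrite /qclass !linearP. Qed.

HB.instance Definition _ U W :=
  GRing.isLinear.Build K vT (quotv U W) *:%R (@qclass U W)
    (@qclass_linear U W).

Lemma qrepr_mem U W (q : quotv U W) : qrepr q \in U.
Proof. exact: (subvP (diffvSl U W)) (subvsP q). Qed.

Lemma qreprK U W : cancel (@qrepr U W) (@qclass U W).
Proof.
move=> q; apply: val_inj; rewrite /= vsprojK ?memv_pi //.
by rewrite /addv_pi1 daddv_pi_id ?capv_diff ?subvsP.
Qed.

Lemma qclassK U W x : x \in U -> x - qrepr (qclass U W x) \in W.
Proof.
move=> Ux; rewrite /qrepr vsprojK ?memv_pi //.
have {1}<- := @addv_pi1_pi2 _ _ U W x _; last exact: (subvP (addvSl U W)).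
by rewrite addrC addKr memv_pi2.
Qed.

Lemma qclass_eq0 U W x : (W <= U)%VS -> x \in U ->
  (qclass U W x == 0) = (x \in W).
Proof.
move=> sWU Ux; apply/eqP/idP => [q0 | Wx].
  by have := qclassK W Ux; rewrite q0 (raddf0 (@qrepr U W)) subr0.
apply: val_inj; apply/eqP.
rewrite -memv0 -(capv_diff U W) memv_cap subvsP /=.
by have := qclassK W Ux; rewrite rpredBl.
Qed.

End Quotient.

Section FamilySum.
Variables (K : fieldType) (n : nat) (V : 'I_n -> vectType K).

Definition dsum := {dffun forall i : 'I_n, V i}.

HB.instance Definition _ := Choice.on dsum.

Implicit Types x y z : dsum.

Definition dsum_of (f : forall i, V i) : dsum := finfun f.

Lemma dsumE f i : dsum_of f i = f i. Proof. exact: ffunE. Qed.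

Lemma dsumP x y : (forall i, x i = y i) <-> x = y.
Proof. exact: ffunP. Qed.

Definition dsum0 : dsum := dsum_of (fun _ => 0).
Definition dsum_add x y : dsum := dsum_of (fun i => x i + y i).
Definition dsum_opp x : dsum := dsum_of (fun i => - x i).
Definition dsum_scale (a : K) x : dsum := dsum_of (fun i => a *: x i).

Fact dsum_addA : associative dsum_add.
Proof. by move=> x y z; apply/dsumP => i; rewrite !dsumE addrA. Qed.
Fact dsum_addC : commutative dsum_add.
Proof. by move=> x y; apply/dsumP => i; rewrite !dsumE addrC. Qed.
Fact dsum_add0 : left_id dsum0 dsum_add.
Proof. by move=> x; apply/dsumP => i; rewrite !dsumE add0r. Qed.
Fact dsum_addN : left_inverse dsum0 dsum_opp dsum_add.
Proof. by move=> x; apply/dsumP => i; rewrite !dsumE addNr. Qed.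

HB.instance Definition _ :=
  GRing.isZmodule.Build dsum dsum_addA dsum_addC dsum_add0 dsum_addN.

Lemma dsum0E i : (0 : dsum) i = 0. Proof. exact: dsumE. Qed.
Lemma dsumDE x y i : (x + y) i = x i + y i. Proof. exact: dsumE. Qed.

Fact dsum_scaleA a b x : dsum_scale a (dsum_scale b x) = dsum_scale (a * b) x.
Proof. by apply/dsumP => i; rewrite !dsumE scalerA. Qed.
Fact dsum_scale1 : left_id 1 dsum_scale.
Proof. by move=> x; apply/dsumP => i; rewrite !dsumE scale1r. Qed.
Fact dsum_scaleDr : right_distributive dsum_scale +%R.
Proof.
by move=> a x y; apply/dsumP => i; rewrite !(dsumE, dsumDE) scalerDr.
Qed.
Fact dsum_scaleDl x : {morph dsum_scale^~ x : a b / a + b}.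
Proof.
by move=> a b; apply/dsumP => i; rewrite !(dsumE, dsumDE) scalerDl.
Qed.

HB.instance Definition _ :=
  GRing.Zmodule_isLmodule.Build K dsum
    dsum_scaleA dsum_scale1 dsum_scaleDr dsum_scaleDl.

Lemma dsumZE a x i : (a *: x) i = a *: x i. Proof. exact: dsumE. Qed.

Import VectorInternalTheory.

Fact dsum_vect_iso : Vector.axiom (\sum_(i < n) dim (V i)) dsum.
Proof.
exists (fun x => \mxrow_(i < n) v2r (x i)).
  by move=> a x y; apply/rowP => j; rewrite !mxE dsumDE dsumZE linearP !mxE.
exists (fun r => dsum_of (fun i => r2v (submxrow r i))) => [x | r].
  by apply/dsumP => i; rewrite dsumE mxrowK v2rK.
rewrite -[RHS]submxrowK; apply: eq_mxrow => i.
by rewrite dsumE r2vK.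
Qed.

HB.instance Definition _ := Lmodule_hasFinDim.Build K dsum dsum_vect_iso.

End FamilySum.

Section Graded.
Variables (K : fieldType) (A : assocAlgType K).

Local Notation d := (\dim {:A}).

(* A_i = A^i / A^(i+1), for i >= 1 *)
Definition grpiece (i : nat) : vectType K := quotv (apow A i) (apow A i.+1).

Definition grclass (i : nat) (a : A) : grpiece i := qclass _ _ a.
Definition grrepr (i : nat) (q : grpiece i) : A := qrepr q.

Lemma grreprP i a (p q : grpiece i) :
  grrepr (a *: p + q) = a *: grrepr p + grrepr q.
Proof. exact: linearP. Qed.

Lemma grclassP i a (u v : A) :
  grclass i (a *: u + v) = a *: grclass i u + grclass i v.
Proof. exact: linearP. Qed.

(* The sum of the A_i, where the piece A_i sits at index i.-1; it may stop at
   i = dim A since the descending chain of powers of an associative algebra is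
   stationary from the first i such that A^i = A^(i+1). *)
Definition gr := dsum (fun i : 'I_d => grpiece i.+1).

HB.instance Definition _ := Vector.on gr.

Implicit Types x y z : gr.

(* [x_i] * [y_j] = [x_i y_j] in A_(i+j) *)
Definition gr_mul x y : gr :=
  dsum_of (fun k => \sum_(i < d) \sum_(j < d | (i.+1 + j.+1 == k.+1)%N)
                      grclass k.+1 (grrepr (x i) ** grrepr (y j))).

Lemma gr_mulE x y k :
  gr_mul x y k = \sum_(i < d) \sum_(j < d | (i.+1 + j.+1 == k.+1)%N)
                      grclass k.+1 (grrepr (x i) ** grrepr (y j)).
Proof. exact: dsumE. Qed.

Lemma grclassMl i j m a b : (i.+1 + j.+1 = m)%N ->
  a \in apow A i.+1 -> b \in apow A j.+1 ->
  grclass m (grrepr (grclass i.+1 a) ** b) = grclass m (a ** b).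
Proof.
move=> <- Aa Ab; apply/eqP.
rewrite eq_sym -subr_eq0 -[X in X == 0]raddfB -amulBl qclass_eq0 ?apow_sub //.
  by rewrite -addSn memv_apowM // qclassK.
by rewrite memv_apowM // rpredB // qrepr_mem.
Qed.

Lemma grclassMr i j m a b : (i.+1 + j.+1 = m)%N ->
  a \in apow A i.+1 -> b \in apow A j.+1 ->
  grclass m (a ** grrepr (grclass j.+1 b)) = grclass m (a ** b).
Proof.
move=> <- Aa Ab; apply/eqP.
rewrite eq_sym -subr_eq0 -[X in X == 0]raddfB -amulBr qclass_eq0 ?apow_sub //.
  by rewrite -addnS memv_apowM // qclassK.
by rewrite memv_apowM // rpredB // qrepr_mem.
Qed.

Lemma grclass_sum m I r (P : pred I) (F : I -> A) :
  grclass m (\sum_(i <- r | P i) F i) = \sum_(i <- r | P i) grclass m (F i).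
Proof. exact: raddf_sum. Qed.

Lemma grrepr_sum m I r (P : pred I) (F : I -> grpiece m) :
  grrepr (\sum_(i <- r | P i) F i) = \sum_(i <- r | P i) grrepr (F i).
Proof. exact: raddf_sum. Qed.

Lemma sum_degrees (V : zmodType) (m i : 'I_d) (F : 'I_d -> 'I_d -> V) :
  \sum_(l < d | (i.+1 + l.+1 == m.+1)%N)
     \sum_(j < d) \sum_(k < d | (j.+1 + k.+1 == l.+1)%N) F j k =
  \sum_(j < d) \sum_(k < d | (i.+1 + (j.+1 + k.+1) == m.+1)%N) F j k.
Proof.
rewrite exchange_big; apply: eq_bigr => j _ /=.
rewrite (exchange_big_dep xpredT) //= [RHS]big_mkcond; apply: eq_bigr => k _.
case: eqP => [e | ne].
  have lt_l : (j + k.+1 < d)%N by have := ltn_ord m; lia.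
  rewrite (big_pred1 (Ordinal lt_l)) // => l; rewrite /= -val_eqE /=.
  by apply/idP/idP; lia.
by rewrite big_pred0 // => l; apply/negbTE; lia.
Qed.

Fact gr_mulA : associative gr_mul.
Proof.
move=> x y z; apply/dsumP => m; rewrite !gr_mulE.
transitivity (\sum_(i < d) \sum_(j < d)
    \sum_(k < d | (i.+1 + (j.+1 + k.+1) == m.+1)%N)
      grclass m.+1 (grrepr (x i) ** grrepr (y j) ** grrepr (z k))).
  apply: eq_bigr => i _; rewrite -sum_degrees; apply: eq_bigr => l /eqP eil.
  rewrite gr_mulE grrepr_sum amul_sumr grclass_sum; apply: eq_bigr => j _.
  rewrite grrepr_sum amul_sumr grclass_sum; apply: eq_bigr => k /eqP ejk.
  rewrite (grclassMr eil) ?amulA ?qrepr_mem //.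
  by rewrite -ejk memv_apowM ?qrepr_mem.
rewrite [RHS](exchange_big_dep xpredT) //=.
transitivity (\sum_(k < d) \sum_(i < d)
    \sum_(j < d | (k.+1 + (i.+1 + j.+1) == m.+1)%N)
      grclass m.+1 (grrepr (x i) ** grrepr (y j) ** grrepr (z k))).
  rewrite [RHS]exchange_big; apply: eq_bigr => i _ /=.
  rewrite [RHS](exchange_big_dep xpredT) //=; apply: eq_bigr => j _.
  by apply: eq_bigl => k; rewrite addnA addnC.
apply: eq_bigr => k _; rewrite -sum_degrees.
apply: eq_big => [l | l /eqP ekl]; first by rewrite addnC.
have elk : (l.+1 + k.+1 = m.+1)%N by rewrite addnC.
rewrite gr_mulE grrepr_sum amul_suml grclass_sum; apply: eq_bigr => i _.
rewrite grrepr_sum amul_suml grclass_sum; apply: eq_bigr => j /eqP eij.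
rewrite (grclassMl elk) ?qrepr_mem //.
by rewrite -eij memv_apowM ?qrepr_mem.
Qed.

Fact gr_mul_linearl y : linear (gr_mul^~ y).
Proof.
move=> a x x'; apply/dsumP => k; rewrite dsumDE dsumZE !gr_mulE.
rewrite scaler_sumr -big_split; apply: eq_bigr => i _ /=.
rewrite scaler_sumr -big_split; apply: eq_bigr => j _ /=.
by rewrite dsumDE dsumZE grreprP amulDl amulZl grclassP.
Qed.

Fact gr_mul_linearr x : linear (gr_mul x).
Proof.
move=> a y y'; apply/dsumP => k; rewrite dsumDE dsumZE !gr_mulE.
rewrite scaler_sumr -big_split; apply: eq_bigr => i _ /=.
rewrite scaler_sumr -big_split; apply: eq_bigr => j _ /=.
by rewrite dsumDE dsumZE grreprP amulDr amulZr grclassP.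
Qed.

HB.instance Definition _ :=
  Vector_isAssocAlg.Build K gr gr_mulA gr_mul_linearl gr_mul_linearr.

(* x lies in the summand A_i of gr A *)
Definition gr_homogeneous (i : nat) (x : gr) : Prop :=
  forall j : 'I_d, j.+1 != i -> x j = 0.

End Graded.

Definition naturally_graded (K : fieldType) (A : assocAlgType K) : Prop :=
  alg_iso (gr A) A.

Section CharacteristicSequence.
Variables (K : fieldType).

(* [s] is the decreasing sequence of the sizes of the Jordan blocks of the
   nilpotent operator [f]: some basis is a union of Jordan chains
   v, f v, ..., f^(m-1) v with f^m v = 0, one for each entry m of [s]. *)
Definition jordan_sizes (V : vectType K) (f : V -> V) (s : seq nat) : Prop :=
  [/\ sorted geq s, 0%N \notin s &
   exists vs : seq V,
     [/\ size vs = size s,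
         forall p, p \in zip vs s -> iter p.2 f p.1 = 0 &
         basis_of fullv (flatten [seq traject f p.1 p.2 | p <- zip vs s])]].

Variable A : assocAlgType K.

(* C(A) = s, i.e. s is the lexicographic maximum of the C(x), x in A \ A^2.
   C is handled as a relation: for A nilpotent, every [amul x] is a nilpotent
   operator, so its sizes exist and are unique. *)
Definition characteristic_sequence (s : seq nat) : Prop :=
  (exists2 x : A, x \notin apow A 2 & jordan_sizes (amul x) s) /\
  (forall (x : A) (s' : seq nat), x \notin apow A 2 ->
     jordan_sizes (amul x) s' -> ((s' : seqlexi nat) <= s)%O).

Definition two_filiform : Prop :=
  characteristic_sequence [:: (\dim {:A} - 2)%N; 1%N; 1%N].

(* A is identified with gr A: the homogeneous basis lives in gr A. *)
Definition type_mu (t1 t2 : nat) : Prop :=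
  let n := \dim {:A} in
  (1 <= t1 <= t2)%N /\
  exists (e : nat -> gr A) (f1 f2 : gr A),
    [/\ basis_of fullv ([seq e i | i <- iota 1 (n - 2)] ++ [:: f1; f2]),
        forall i, (1 <= i <= n - 2)%N -> gr_homogeneous i (e i),
        gr_homogeneous t1 f1 /\ gr_homogeneous t2 f2,
        forall i j, (1 <= i <= n - 2)%N -> (1 <= j <= n - 2)%N ->
          e i ** e j = if (i + j <= n - 2)%N then e (i + j)%N else 0 &
        forall k, (1 <= k <= n - 2)%N -> e k ** f1 = 0 /\ e k ** f2 = 0].

End CharacteristicSequence.

Section StructureConstants.
Variables (K : fieldType) (n : nat).

(* e_i, for 1 <= i <= n *)
Definition stdb (i : nat) : 'rV[K]_n := \row_(j < n) (j.+1 == i)%:R.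

(* the bilinear product such that e_i e_j = c i j *)
Definition sc_mul (c : nat -> nat -> 'rV[K]_n) (x y : 'rV[K]_n) : 'rV[K]_n :=
  \sum_(i < n) \sum_(j < n) (x 0 i * y 0 j) *: c i.+1 j.+1.

Variable c : nat -> nat -> 'rV[K]_n.

Fact sc_mul_linearl y : linear (sc_mul c ^~ y).
Proof.
move=> a x x'; rewrite /sc_mul scaler_sumr -big_split; apply: eq_bigr => i _ /=.
rewrite scaler_sumr -big_split; apply: eq_bigr => j _ /=.
by rewrite !mxE mulrDl scalerDl scalerA mulrA.
Qed.

Fact sc_mul_linearr x : linear (sc_mul c x).
Proof.
move=> a y y'; rewrite /sc_mul scaler_sumr -big_split; apply: eq_bigr => i _ /=.
rewrite scaler_sumr -big_split; apply: eq_bigr => j _ /=.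
by rewrite !mxE mulrDr scalerDl scalerA mulrCA.
Qed.

HB.instance Definition _ x :=
  GRing.isLinear.Build K 'rV[K]_n 'rV[K]_n *:%R (sc_mul c x)
    (sc_mul_linearr x).

Definition sc_mulr y x := sc_mul c x y.

HB.instance Definition _ y :=
  GRing.isLinear.Build K 'rV[K]_n 'rV[K]_n *:%R (sc_mulr y)
    (sc_mul_linearl y).

Lemma stdb_sum (x : 'rV[K]_n) : x = \sum_(i < n) x 0 i *: stdb i.+1.
Proof.
rewrite [LHS]row_sum_delta; apply: eq_bigr => i _; congr (_ *: _).
by apply/rowP => j; rewrite !mxE eqxx eqSS.
Qed.

Lemma sc_mul_stdb i j : (0 < i <= n)%N -> (0 < j <= n)%N ->
  sc_mul c (stdb i) (stdb j) = c i j.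
Proof.
case: i => // i lt_i; case: j => // j lt_j; rewrite /sc_mul.
rewrite (bigD1 (Ordinal lt_i)) //= (bigD1 (Ordinal lt_j)) //=.
rewrite !mxE !eqxx mulr1 scale1r big1 ?addr0 => [|k ne_k].
  rewrite big1 ?addr0 // => k ne_k; rewrite big1 // => l _.
  by rewrite mxE eqSS -[k == i :> nat]/(k == Ordinal lt_i) (negPf ne_k) mul0r scale0r.
by rewrite !mxE !eqSS -[k == j :> nat]/(k == Ordinal lt_j) (negPf ne_k) mulr0 scale0r.
Qed.

Lemma sc_mul0l y : sc_mul c 0 y = 0.
Proof. exact: (raddf0 (sc_mulr y)). Qed.

Lemma sc_mul0r x : sc_mul c x 0 = 0.
Proof. exact: raddf0. Qed.

Lemma sc_mulA :
  (forall i j k, (0 < i <= n)%N -> (0 < j <= n)%N -> (0 < k <= n)%N ->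
     sc_mul c (stdb i) (c j k) = sc_mul c (c i j) (stdb k)) ->
  associative (sc_mul c).
Proof.
move=> cA; have {}cA (i j k : 'I_n) :
    sc_mul c (stdb i.+1) (sc_mul c (stdb j.+1) (stdb k.+1)) =
    sc_mul c (sc_mul c (stdb i.+1) (stdb j.+1)) (stdb k.+1).
  by rewrite !sc_mul_stdb ?cA //=.
have linl y : linear (sc_mul c ^~ y) := sc_mul_linearl y.
have linr x : linear (sc_mul c x) := sc_mul_linearr x.
move: (sc_mul c) linl linr cA => m linl linr cA.
pose mr y := GRing.isLinear.Build K _ _ *:%R (m^~ y) (linl y).
pose ml x := GRing.isLinear.Build K _ _ *:%R (m x) (linr x).
pose Mr y : {linear 'rV[K]_n -> 'rV[K]_n} := HB.pack (m^~ y) (mr y).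
pose Ml x : {linear 'rV[K]_n -> 'rV[K]_n} := HB.pack (m x) (ml x).
have suml (a : 'I_n -> K) F y :
    m (\sum_(i < n) a i *: F i) y = \sum_(i < n) a i *: m (F i) y.
  rewrite [LHS](raddf_sum (Mr y)); apply: eq_bigr => i _.
  exact: (linearZ_LR (Mr y)).
have sumr (a : 'I_n -> K) F x :
    m x (\sum_(i < n) a i *: F i) = \sum_(i < n) a i *: m x (F i).
  rewrite [LHS](raddf_sum (Ml x)); apply: eq_bigr => i _.
  exact: (linearZ_LR (Ml x)).
move=> x y z; rewrite (stdb_sum x) !suml; apply: eq_bigr => i _.
congr (_ *: _); rewrite (stdb_sum y) suml !sumr suml; apply: eq_bigr => j _.
congr (_ *: _); rewrite (stdb_sum z) !sumr; apply: eq_bigr => k _.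
by rewrite cA.
Qed.

End StructureConstants.

Section Lambda.
Variable K : fieldType.
Local Notation e := (stdb K 5).

Definition lambda1_sc (i j : nat) : 'rV[K]_5 :=
  match i, j with
  | 1, 1 => e 2
  | 1, 2 | 2, 1 => e 3
  | 4, 1 => e 5
  | _, _ => 0
  end.

Definition lambda2_sc (i j : nat) : 'rV[K]_5 :=
  match i, j with
  | 1, 1 => e 2
  | 1, 2 | 2, 1 => e 3
  | 4, 1 => e 5
  | 4, 2 | 5, 1 => e 3
  | _, _ => 0
  end.

Fact lambda1_mulA : associative (sc_mul lambda1_sc).
Proof.
apply: sc_mulA.
move=> [|[|[|[|[|[|i]]]]]] [|[|[|[|[|[|j]]]]]] [|[|[|[|[|[|k]]]]]] //= _ _ _;
  by rewrite ?sc_mul0l ?sc_mul0r ?sc_mul_stdb.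
Qed.

Fact lambda2_mulA : associative (sc_mul lambda2_sc).
Proof.
apply: sc_mulA.
move=> [|[|[|[|[|[|i]]]]]] [|[|[|[|[|[|j]]]]]] [|[|[|[|[|[|k]]]]]] //= _ _ _;
  by rewrite ?sc_mul0l ?sc_mul0r ?sc_mul_stdb.
Qed.

Definition lambda1 := 'rV[K]_5.
HB.instance Definition _ := Vector.on lambda1.
HB.instance Definition _ :=
  Vector_isAssocAlg.Build K lambda1
    lambda1_mulA (sc_mul_linearl _) (sc_mul_linearr _).

Definition lambda2 := 'rV[K]_5.
HB.instance Definition _ := Vector.on lambda2.
HB.instance Definition _ :=
  Vector_isAssocAlg.Build K lambda2
    lambda2_mulA (sc_mul_linearl _) (sc_mul_linearr _).

End Lambda.

(* Main.v *)
(** Associativity and homogeneity force the unknown products in gr A to be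
    f1 e1 = b f2, f1 f1 = d f2, f2 e1 = be e3, f1 e2 = b be e3,
    f1 f2 = g e3, f2 f1 = de e3.  Since gr A is generated in degree 1, f2 is a
    sum of products, so (b, d) <> (0, 0).  If d <> 0, left multiplication by
    e1 + f1 has Jordan blocks of sizes (3, 2) > (3, 1, 1), against
    2-filiformity; hence d = 0, b <> 0 and then g = de = 0.  Rescaling f1 and
    f2 leaves lambda1 (be = 0) or lambda2 (be <> 0), which are told apart by
    the dimension of their two-sided annihilator. *)

Require Import Defs.
From HB Require Import structures.
From mathcomp Require Import all_boot all_order all_algebra.
From mathcomp Require Import reals complex.
From mathcomp Require Import zify.

Set Implicit Arguments.
Unset Strict Implicit.
Unset Printing Implicit Defensive.

Local Open Scope ring_scope.
Import GRing.Theory.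
Local Open Scope assoc_alg_scope.

(** * Algebras given by a multiplication table on a basis *)

Section StructureBases.
Variables (K : fieldType) (n : nat) (c : nat -> nat -> 'rV[K]_n).

Definition comb (A : vectType K) (X : n.-tuple A) (r : 'rV[K]_n) : A :=
  \sum_(k < n) r 0 k *: X`_k.

Definition sc_basis (A : assocAlgType K) (X : n.-tuple A) : Prop :=
  basis_of fullv X /\
  forall i j : 'I_n, X`_i ** X`_j = comb X (c i.+1 j.+1).

(** Serves to carry a table from [gr A], where the homogeneous basis lives, to [A], where
    2-filiformity is stated. *)
Lemma sc_basis_iso (A B : assocAlgType K) (phi : {linear A -> B})
    (X : n.-tuple A) :
  bijective phi -> (forall x y, phi (x ** y) = phi x ** phi y) ->
  sc_basis X -> sc_basis (map_tuple phi X).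
Proof.
move=> [psi phiK psiK] phiM [bX mX]; split.
  have kerphi : (lker (linfun phi) == 0)%VS.
    apply/lker0P => x y; rewrite !lfunE /=; exact: (can_inj phiK).
  have -> : map_tuple phi X = [seq linfun phi x | x <- X] :> seq B.
    by apply: eq_map => x; rewrite lfunE.
  have -> : fullv = (linfun phi @: fullv)%VS :> {vspace B}.
    apply/eqP; rewrite eqEsubv subvf andbT; apply/subvP => y _.
    by rewrite -(psiK y) -(lfunE phi) memv_img ?memvf.
  apply: limg_basis_of bX; rewrite (eqP kerphi) capv0 //.
move=> i j; rewrite /= !(nth_map 0) ?size_tuple // -phiM mX /comb.
rewrite linear_sum; apply: eq_bigr => k _.
by rewrite linearZ_LR (nth_map 0) ?size_tuple.
Qed.

Variables (A : assocAlgType K) (X : n.-tuple A).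
Hypothesis scX : sc_basis X.

Let coordE x : x = \sum_(i < n) coord X i x *: X`_i.
Proof. by apply: coord_basis (memvf x); case: scX. Qed.

Lemma coord_mul k x y :
  coord X k (x ** y) =
  \sum_(i < n) \sum_(j < n) coord X i x * coord X j y * c i.+1 j.+1 0 k.
Proof.
have [bX mX] := scX.
rewrite {1}(coordE x) {1}(coordE y) amul_suml linear_sum.
apply: eq_bigr => i _; rewrite amul_sumr linear_sum; apply: eq_bigr => j _.
rewrite amulZl amulZr !linearZ_LR /= mX coord_sum_free ?(basis_free bX) //.
by rewrite /= mulrA.
Qed.

(** $A^2$ is spanned by products, so the coordinate along a basis vector that occurs nowhere in the
    table is a linear form vanishing on $A^2$. *)
Lemma coord_apow2 k z :
  (forall i j : 'I_n, c i.+1 j.+1 0 k = 0) -> z \in apow A 2 ->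
  coord X k z = 0.
Proof.
move=> c0; rewrite (apowS _ (isT : 0 < 1)%N) big_nat1 apow1.
have sub : (mulv fullv fullv <= lker (linfun (coord X k : A -> K^o)))%VS.
  apply/mulvP => x y _ _; rewrite memv_ker lfunE /= coord_mul.
  by apply/eqP; rewrite big1 // => i _; rewrite big1 // => j _; rewrite c0 mulr0.
by move/(subvP sub); rewrite memv_ker lfunE /= => /eqP.
Qed.

Lemma sc_basis_rV :
  exists phi : {linear A -> 'rV[K]_n},
    bijective phi /\ forall x y, phi (x ** y) = sc_mul c (phi x) (phi y).
Proof.
have [bX _] := scX.
pose f x : 'rV[K]_n := \row_i coord X i x.
have lf : linear f by move=> a x y; apply/rowP => i; rewrite !mxE linearP.
pose fl := GRing.isLinear.Build K A 'rV[K]_n *:%R f lf.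
exists (HB.pack f fl : {linear A -> 'rV[K]_n}) => /=; split.
  exists (comb X) => [x | r]; last first.
    by apply/rowP => i; rewrite mxE coord_sum_free ?(basis_free bX).
  by rewrite {2}(coordE x); apply: eq_bigr => i _; rewrite mxE.
move=> x y; apply/rowP => k; rewrite mxE coord_mul summxE.
apply: eq_bigr => i _; rewrite summxE; apply: eq_bigr => j _.
by rewrite !mxE.
Qed.

End StructureBases.

(** * Homogeneous elements and their products in the associated graded algebra *)

Section GradedBasis.
Variables (K : fieldType) (A : assocAlgType K).
Local Notation d := (\dim {:A}).

Lemma grrepr0 m : grrepr (0 : grpiece A m) = 0.
Proof. by rewrite /grrepr raddf0. Qed.

Lemma grclass0 m : grclass m (0 : A) = 0.
Proof. by rewrite /grclass raddf0. Qed.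

Definition grproj m (x : gr A) : gr A :=
  dsum_of (fun k : 'I_d => if k.+1 == m then x k else 0).

Fact grproj_linear m : linear (grproj m).
Proof.
move=> a x y; apply/dsumP => k; rewrite dsumDE dsumZE !dsumE.
by case: ifP => // _; rewrite scaler0 addr0.
Qed.

HB.instance Definition _ m :=
  GRing.isLinear.Build K (gr A) (gr A) *:%R (grproj m) (grproj_linear m).

Lemma grproj_homogeneous m i (x : gr A) :
  gr_homogeneous i x -> grproj m x = if i == m then x else 0.
Proof.
move=> hx; apply/dsumP => k; rewrite dsumE.
case: (altP (i =P m)) => [<- | ne_im].
  by case: ifP => // /negbT ne; rewrite hx.
by rewrite dsum0E; case: eqP => // ek; rewrite hx // ek eq_sym.
Qed.

Lemma gr_homogeneousM i j (x y : gr A) :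
  gr_homogeneous i x -> gr_homogeneous j y -> gr_homogeneous (i + j)%N (x ** y).
Proof.
move=> hx hy k ne_k; rewrite [LHS]gr_mulE big1 // => p _.
rewrite big1 // => q /eqP epq.
have [ep | ne_p] := eqVneq p.+1 i; last first.
  by rewrite hx // grrepr0 amul0l grclass0.
have -> : y q = 0.
  by apply: hy; apply: contraNneq ne_k => eq; rewrite -epq ep eq.
by rewrite grrepr0 amul0r grclass0.
Qed.

(** A homogeneous element is its own projection to degree [m], and this projection erases the basis
    vectors of other degrees. *)
Lemma homogeneous_coord n (X : n.-tuple (gr A)) (dg : 'I_n -> nat) m x :
  basis_of fullv X -> (forall i, gr_homogeneous (dg i) X`_i) ->
  gr_homogeneous m x ->
  x = \sum_(i < n) (if dg i == m then coord X i x *: X`_i else 0).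
Proof.
move=> bX hX hx.
rewrite -{1}[x](_ : grproj m x = x); last by rewrite (grproj_homogeneous m hx) eqxx.
rewrite {1}(coord_basis bX (memvf x)) linear_sum; apply: eq_bigr => i _.
rewrite linearZ_LR /= (grproj_homogeneous m (hX i)).
by case: ifP => // _; rewrite scaler0.
Qed.

(** The class of [a] in degree [m], meaningful for [a] in $A^m$. Using [grclass k.+1] instead of
    [grclass m] avoids a transport between dependent types. *)
Definition grin m (a : A) : gr A :=
  dsum_of (fun k : 'I_d => if k.+1 == m then grclass k.+1 a else 0).

Fact grin_linear m : linear (grin m).
Proof.
move=> r a b; apply/dsumP => k; rewrite dsumDE dsumZE !dsumE grclassP.
by case: ifP => // _; rewrite scaler0 addr0.
Qed.

HB.instance Definition _ m :=
  GRing.isLinear.Build K A (gr A) *:%R (grin m) (grin_linear m).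

(** Only one term of the double sum defining the product survives; if the total degree exceeds [d],
    both sides are 0. *)
Lemma grinM i j a b : a \in apow A i.+1 -> b \in apow A j.+1 ->
  grin i.+1 a ** grin j.+1 b = grin (i.+1 + j.+1)%N (a ** b).
Proof.
move=> Aa Ab; apply/dsumP => k; rewrite [LHS]gr_mulE dsumE.
case: eqP => [ek | ne_k]; last first.
  rewrite big1 // => p _; rewrite big1 // => q /eqP epq; rewrite !dsumE.
  case: eqP => [ep | _]; last by rewrite grrepr0 amul0l grclass0.
  case: eqP => [eq | _]; last by rewrite grrepr0 amul0r grclass0.
  by case: ne_k; rewrite -epq ep eq.
have lt_i : (i < d)%N by have := ltn_ord k; lia.
have lt_j : (j < d)%N by have := ltn_ord k; lia.
rewrite (bigD1 (Ordinal lt_i)) //= (bigD1 (Ordinal lt_j)) ?ek //=.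
rewrite !dsumE !eqxx /= (grclassMl erefl) ?qrepr_mem //.
rewrite (grclassMr erefl) //.
rewrite big1 => [|q /andP[_ ne_q]]; last first.
  by rewrite dsumE ifN ?grrepr0 ?amul0r ?grclass0.
rewrite addr0 big1 ?addr0 // => p ne_p; rewrite big1 // => q _.
by rewrite dsumE ifN ?grrepr0 ?amul0l ?grclass0.
Qed.

(** The piece of degree 2 consists of classes of elements of $A^2$, that is, of sums of products
    $uv$; the class of $uv$ is the product of the degree 1 classes of $u$ and $v$. *)
Lemma homogeneous2_apow2 (x : gr A) :
  (1 < d)%N -> gr_homogeneous 2 x -> x \in apow (gr A) 2.
Proof.
move=> d_gt1 hx; pose k := Ordinal d_gt1.
have -> : x = grin 2 (grrepr (x k)).
  apply/dsumP => l; rewrite dsumE; case: eqP => [el | /eqP/hx //].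
  have -> : l = k by apply: val_inj; case: el.
  by rewrite /grclass /grrepr qreprK.
have := qrepr_mem (x k); rewrite -[qrepr _]/(grrepr (x k)) /=.
rewrite (apowS _ (isT : 0 < 1)%N) big_nat1 apow1 => Ax.
have sub : (mulv fullv fullv <= linfun (grin 2) @^-1: apow (gr A) 2)%VS.
  apply/mulvP => u v _ _; rewrite -memv_preim lfunE /= -(@grinM 0 0) ?memvf //.
  by apply: (@memv_apowM _ _ 1 1); rewrite ?apow1 ?memvf.
by have := subvP sub _ Ax; rewrite -memv_preim lfunE.
Qed.

End GradedBasis.

(** * The five-parameter family of tables of type $\mu(1,2)$ *)

Section TypeMu12.
Variables (K : fieldType) (b d be g de : K).
Local Notation e := (stdb K 5).

(** Indices 4 and 5 stand for [f1] and [f2]. *)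
Definition mu12_sc (i j : nat) : 'rV[K]_5 :=
  match i, j with
  | 1, 1 => e 2
  | 1, 2 | 2, 1 => e 3
  | 4, 1 => b *: e 5
  | 4, 4 => d *: e 5
  | 4, 2 => (b * be) *: e 3
  | 5, 1 => be *: e 3
  | 4, 5 => g *: e 3
  | 5, 4 => de *: e 3
  | _, _ => 0
  end.

Variables (A : assocAlgType K) (e1 e2 e3 f1 f2 : A).
Hypothesis scA : sc_basis mu12_sc [tuple e1; e2; e3; f1; f2].

(** The equations form a single tuple so that one [rewrite] evaluates any product of basis
    vectors. *)
Lemma mu12_mulE :
  (e1 ** e1 = e2) * (e1 ** e2 = e3) * (e1 ** e3 = 0) * (e1 ** f1 = 0) *
  (e1 ** f2 = 0) *
  (e2 ** e1 = e3) * (e2 ** e2 = 0) * (e2 ** e3 = 0) * (e2 ** f1 = 0) *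
  (e2 ** f2 = 0) *
  (e3 ** e1 = 0) * (e3 ** e2 = 0) * (e3 ** e3 = 0) * (e3 ** f1 = 0) *
  (e3 ** f2 = 0) *
  (f1 ** e1 = b *: f2) * (f1 ** e2 = (b * be) *: e3) * (f1 ** e3 = 0) *
  (f1 ** f1 = d *: f2) * (f1 ** f2 = g *: e3) *
  (f2 ** e1 = be *: e3) * (f2 ** e2 = 0) * (f2 ** e3 = 0) *
  (f2 ** f1 = de *: e3) * (f2 ** f2 = 0).
Proof.
have M i j (hi : (i < 5)%N) (hj : (j < 5)%N) :=
  scA.2 (Ordinal hi) (Ordinal hj).
pose row i hi := (M i 0 hi isT, M i 1 hi isT, M i 2 hi isT, M i 3 hi isT,
                  M i 4 hi isT)%N.
have := (row 0 isT, row 1 isT, row 2 isT, row 3 isT, row 4 isT)%N.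
rewrite /= => E; do !split; rewrite E /comb !big_ord_recl big_ord0 !mxE /=.
all: by rewrite ?(mulr0, mulr1, scale0r, scale1r, add0r, addr0).
Qed.


Lemma mu12_basis : basis_of fullv [:: e1; e2; e3; f1; f2].
Proof. by case: scA. Qed.

Lemma mu12_scale_e3I x y : x *: e3 = y *: e3 -> x = y.
Proof.
have e3_neq0 : e3 != 0.
  by apply: free_not0 (basis_free mu12_basis) _; rewrite !inE eqxx !orbT.
move/eqP; rewrite -subr_eq0 -scalerBl scaler_eq0 (negPf e3_neq0) orbF subr_eq0.
by move/eqP.
Qed.

(** These are the [e3]-coefficients of associativity on the triples (f1, e1, f1), (f1, f1, e1) and
    (f1, f1, f1). *)
Lemma mu12_relations : [/\ b * de = 0, d * be = b * g & d * de = d * g].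
Proof.
split; apply: mu12_scale_e3I.
- have := amulA f1 e1 f1.
  by rewrite !mu12_mulE amul0r amulZl mu12_mulE scalerA scale0r.
- have := amulA f1 f1 e1.
  by rewrite !mu12_mulE amulZl amulZr !mu12_mulE !scalerA.
- have := amulA f1 f1 f1.
  by rewrite !mu12_mulE amulZl amulZr !mu12_mulE !scalerA.
Qed.

Lemma mu12_full_basis (Y : seq A) :
  size Y = 5 -> {subset [:: e1; e2; e3; f1; f2] <= <<Y>>%VS} ->
  basis_of fullv Y.
Proof.
move=> sY sub; rewrite basisEdim sY.
have /andP[/eqP <- _] := mu12_basis; apply/andP; split; first exact/span_subvP.
by rewrite (span_basis mu12_basis) (size_basis scA.1).
Qed.

Lemma mu12_jordan32 : d != 0 -> jordan_sizes (amul (e1 + f1)) [:: 3; 2]%N.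
Proof.
move=> d_neq0; have [bde dbe dde] := mu12_relations.
(* With [d] invertible the relations collapse to $de = g$, $b g = 0$ and $be = 0$. *)
have deg : de = g := mulfI d_neq0 dde.
have bg : b * g = 0 by rewrite -deg.
have be0 : be = 0.
  by apply/eqP; move/eqP: dbe; rewrite bg mulf_eq0 (negPf d_neq0).
(* The first chain is [e1], [w], [e3]. Since $x^2 f_1 = dg\,e_3$ and $x^2 e_1 = e_3$, subtracting
   $dg\,e_1$ from [f1] yields a [v] whose chain stops after two steps. *)
pose x := e1 + f1; pose v := f1 - (d * g) *: e1; pose w := e2 + b *: f2.
have xe1 : x ** e1 = w by rewrite amulDl !mu12_mulE.
have xf2 : x ** f2 = g *: e3 by rewrite amulDl !mu12_mulE add0r.
have xf1 : x ** f1 = d *: f2 by rewrite amulDl !mu12_mulE add0r.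
have xe3 : x ** e3 = 0 by rewrite amulDl !mu12_mulE add0r.
have xw : x ** w = e3.
  rewrite amulDr amulZr xf2 scalerA bg scale0r addr0.
  by rewrite amulDl !mu12_mulE be0 mulr0 scale0r addr0.
have xv : x ** v = d *: f2 - (d * g) *: w by rewrite amulBr amulZr xf1 xe1.
have xxv : x ** (x ** v) = 0.
  by rewrite xv amulBr !amulZr xf2 xw scalerA subrr.
split=> //; exists [:: e1; v]; split => //.
  move=> p; rewrite !inE => /orP[] /eqP -> /=; first by rewrite xe1 xw.
  by rewrite xxv.
rewrite /= -/x xe1 xw xv; set Y := [:: _; _; _; _; _].
have Ye1 : e1 \in <<Y>>%VS by rewrite memv_span ?inE ?eqxx.
have Yw : w \in <<Y>>%VS by rewrite memv_span ?inE ?eqxx ?orbT.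
have Ye3 : e3 \in <<Y>>%VS by rewrite memv_span ?inE ?eqxx ?orbT.
have Yv : v \in <<Y>>%VS by rewrite memv_span ?inE ?eqxx ?orbT.
have Yf1 : f1 \in <<Y>>%VS.
  by rewrite -(subrK ((d * g) *: e1) f1) rpredD // rpredZ.
have Yf2 : f2 \in <<Y>>%VS.
  rewrite -(scalerK d_neq0 f2) rpredZ //.
  rewrite -(subrK ((d * g) *: w) (d *: f2)) rpredD ?(rpredZ, Yw) //.
  by rewrite memv_span ?inE ?eqxx ?orbT.
have Ye2 : e2 \in <<Y>>%VS by rewrite -(addrK (b *: f2) e2) rpredB ?rpredZ.
apply: mu12_full_basis => // y; rewrite !inE.
by do ![case/predU1P=> [-> // |]] => /eqP ->.
Qed.

(** No product of basis vectors involves [e1], whereas this element has [e1]-coordinate 1. *)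
Lemma mu12_generic_notin_apow2 : e1 + f1 \notin apow A 2.
Proof.
have c0 (i j : 'I_5) : mu12_sc i.+1 j.+1 0 0 = 0.
  case: i j => [[|[|[|[|[|?]]]]] ?] [[|[|[|[|[|?]]]]] ?] //=;
  by rewrite !mxE ?mulr0.
apply/negP => /(coord_apow2 scA c0)/eqP.
have coordE (j : 'I_5) := coord_free j 0 (basis_free scA.1).
rewrite linearD; have /= -> := coordE 0.
have /= -> := coordE (Ordinal (isT : 3 < 5)%N).
by rewrite addr0 oner_eq0.
Qed.

Lemma mu12_filiform_d0 : two_filiform A -> d = 0.
Proof.
case=> _ maxA; apply/eqP/negPn/negP => d_neq0.
have := maxA _ _ mu12_generic_notin_apow2 (mu12_jordan32 d_neq0).
(* In dimension 5 the bound reads (3, 1, 1), and its comparison with (3, 2) computes to false. *)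
by rewrite (size_basis scA.1).
Qed.

Lemma mu12_iso_lambda : b != 0 -> d = 0 ->
  alg_iso A (lambda1 K) \/ alg_iso A (lambda2 K).
Proof.
move=> b_neq0 d0; have [/eqP] := mu12_relations.
rewrite mulf_eq0 (negPf b_neq0) d0 !mul0r => /eqP de0 /esym/eqP.
rewrite mulf_eq0 (negPf b_neq0) => /eqP g0 _.
(* Scaling [f1] by [s] and [f2] by [s * b] normalizes the product of the new [f1] with [e1] to the
   new [f2]. *)
have bY (s : K) : s != 0 ->
    basis_of fullv [tuple e1; e2; e3; s *: f1; (s * b) *: f2].
  move=> s_neq0; apply: mu12_full_basis => // y; rewrite !inE.
  have sb_neq0 : s * b != 0 by rewrite mulf_neq0.
  do ![case/predU1P=> [-> |]].
  - by rewrite memv_span ?inE ?eqxx ?orbT.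
  - by rewrite memv_span ?inE ?eqxx ?orbT.
  - by rewrite memv_span ?inE ?eqxx ?orbT.
  - by rewrite -{1}(scalerK s_neq0 f1) rpredZ // memv_span ?inE ?eqxx ?orbT.
  move/eqP->.
  by rewrite -{1}(scalerK sb_neq0 f2) rpredZ // memv_span ?inE ?eqxx ?orbT.
have [be0 | be_neq0] := eqVneq be 0; [left | right].
- suff /sc_basis_rV[phi] : sc_basis (lambda1_sc K)
      [tuple e1; e2; e3; 1 *: f1; (1 * b) *: f2] by exists phi.
  split; first by rewrite bY ?oner_neq0.
  case=> [[|[|[|[|[|?]]]]] ?] [[|[|[|[|[|?]]]]] ?] //=;
  rewrite /comb !big_ord_recl big_ord0 !mxE /= ?amulZl ?amulZr !mu12_mulE;
  rewrite ?be0 ?d0 ?de0 ?g0;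
  by rewrite ?(mulr0, mul1r, scale0r, scale1r, add0r, addr0, scaler0).
(* The rescaled [f2] times [e1] is $s\,b\,be\,e_3$, and this [s] makes the coefficient 1. *)
- pose s := (b * be)^-1.
  have s_neq0 : s != 0 by rewrite invr_eq0 mulf_neq0.
  have sbe : s * (b * be) = 1 by rewrite mulVf ?mulf_neq0.
  suff /sc_basis_rV[phi] : sc_basis (lambda2_sc K)
      [tuple e1; e2; e3; s *: f1; (s * b) *: f2] by exists phi.
  split; first by rewrite bY.
  case=> [[|[|[|[|[|?]]]]] ?] [[|[|[|[|[|?]]]]] ?] //=;
  rewrite /comb !big_ord_recl big_ord0 !mxE /= ?amulZl ?amulZr !mu12_mulE;
  rewrite ?d0 ?de0 ?g0;
  rewrite ?(mulr0, mul1r, scale0r, scale1r, add0r, addr0, scaler0) ?scalerA //;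
  by rewrite -?mulrA sbe scale1r.
Qed.

End TypeMu12.

(** * Annihilators of the two model algebras *)

Section NonIsomorphism.
Variable K : fieldType.
Local Notation e := (stdb K 5).

Lemma sc_mul_stdbl n (c : nat -> nat -> 'rV[K]_n) i y : (0 < i <= n)%N ->
  sc_mul c (stdb K n i) y = \sum_(j < n) y 0 j *: c i j.+1.
Proof.
move=> hi; rewrite {1}(stdb_sum y) linear_sum; apply: eq_bigr => j _.
by rewrite linearZ_LR /= sc_mul_stdb //= ltn_ord.
Qed.

Lemma sc_mul_stdbr n (c : nat -> nat -> 'rV[K]_n) j x : (0 < j <= n)%N ->
  sc_mul c x (stdb K n j) = \sum_(i < n) x 0 i *: c i.+1 j.
Proof.
move=> hj; rewrite {1}(stdb_sum x) -[LHS]/(sc_mulr c _ _) linear_sum.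
by apply: eq_bigr => i _; rewrite linearZ_LR /= /sc_mulr sc_mul_stdb //= ltn_ord.
Qed.

Lemma lambda1_ann k (z : lambda1 K) : (k = 3 \/ k = 5)%N ->
  (e k : lambda1 K) ** z = 0 /\ z ** (e k : lambda1 K) = 0.
Proof.
have E (x y : lambda1 K) : x ** y = sc_mul (lambda1_sc K) x y by [].
by case=> ->; rewrite !E sc_mul_stdbl // sc_mul_stdbr //;
  split; rewrite !big_ord_recl big_ord0 /= !scaler0 !addr0.
Qed.

(** One has $e_1 y = y_1 e_2 + y_2 e_3$ and $y e_1 = y_1 e_2 + (y_2 + y_5) e_3 + y_4 e_5$, which
    leaves only $y_3$ free. *)
Lemma lambda2_ann (y : lambda2 K) :
  (e 1 : lambda2 K) ** y = 0 -> y ** (e 1 : lambda2 K) = 0 ->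
  y = (y : 'rV[K]_5) 0 (Ordinal (isT : 2 < 5)%N) *: e 3.
Proof.
have E (x z : lambda2 K) : x ** z = sc_mul (lambda2_sc K) x z by [].
rewrite !E sc_mul_stdbl // sc_mul_stdbr // !big_ord_recl !big_ord0 /=.
move=> /rowP L /rowP M.
have := L (Ordinal (isT : 1 < 5)%N); have := L (Ordinal (isT : 2 < 5)%N).
have := M (Ordinal (isT : 2 < 5)%N); have := M (Ordinal (isT : 4 < 5)%N).
rewrite !mxE /= ?(mulr0, mulr1, add0r, addr0) => y4 y25 y2 y1.
have y5 := y25; rewrite y2 add0r in y5.
apply/rowP => -[[|[|[|[|[|?]]]]] ?] //; rewrite !mxE /= ?(mulr0, mulr1);
  [rewrite -[RHS]y1 | rewrite -[RHS]y2 | | rewrite -[RHS]y4 | rewrite -[RHS]y5];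
  by congr (fun_of_matrix _ _ _); apply: val_inj.
Qed.

Lemma lambda1_not_iso_lambda2 : ~ alg_iso (lambda1 K) (lambda2 K).
Proof.
case=> phi [[psi phiK psiK] phiM].
(* Writing [e 1] as a value of [phi] shows that images of annihilating elements are annihilated by
   it on both sides. *)
have img k : (k = 3 \/ k = 5)%N -> exists s, phi (e k) = s *: e 3.
  move=> hk; eexists; apply: lambda2_ann.
    by rewrite -[e 1]psiK -phiM (lambda1_ann _ hk).2 raddf0.
  by rewrite -[e 1]psiK -phiM (lambda1_ann _ hk).1 raddf0.
have [s es] := img 3 (or_introl erefl); have [t et] := img 5 (or_intror erefl).
(* Two independent vectors land on one line; this is the resulting kernel element, and its last
   coordinate gives $s = 0$. *)
have /(can_inj phiK)/rowP E : phi (t *: e 3 - s *: e 5) = phi 0.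
  by rewrite linearB 2!linearZ_LR /= es et !scalerA mulrC subrr raddf0.
have s0 : s = 0.
  have := E (Ordinal (isT : 4 < 5)%N); rewrite !mxE /= mulr0 mulr1 sub0r.
  by move/eqP; rewrite oppr_eq0 => /eqP.
have /(can_inj phiK)/rowP : phi (e 3) = phi 0 by rewrite es s0 scale0r raddf0.
by move/(_ (Ordinal (isT : 2 < 5)%N)); rewrite !mxE /= => /eqP; rewrite oner_eq0.
Qed.

End NonIsomorphism.

(** * Reading the table off the grading and associativity *)

Lemma type_mu12_sc_basis (K : fieldType) (A : assocAlgType K) :
  \dim {:A} = 5%N -> type_mu A 1 2 ->
  exists b d be g de (e1 e2 e3 f1 f2 : gr A),
    sc_basis (mu12_sc b d be g de) [tuple e1; e2; e3; f1; f2] /\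
    (b != 0) || (d != 0).
Proof.
move=> dimA [_ [e [f1 [f2]]]]; rewrite dimA => -[bX he [hf1 hf2] ee ef].
pose X := [tuple e 1%N; e 2%N; e 3%N; f1; f2].
pose dg (i : 'I_5) := nth 0%N [:: 1; 2; 3; 1; 2]%N i.
have {}bX : basis_of fullv X by [].
have hX i : gr_homogeneous (dg i) X`_i.
  by case: i => [[|[|[|[|[|?]]]]] ?] //=; apply: he.
have hom m (x : gr A) : gr_homogeneous m x -> x = _ := homogeneous_coord bX hX.
have hom2 (x : gr A) : gr_homogeneous 2 x -> exists p q, x = p *: e 2%N + q *: f2.
  move/hom; rewrite !big_ord_recl big_ord0 /= ?(add0r, addr0) => Ex.
  by do 2!eexists; exact: Ex.
have hom3 (x : gr A) : gr_homogeneous 3 x -> exists p, x = p *: e 3%N.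
  move/hom; rewrite !big_ord_recl big_ord0 /= ?(add0r, addr0) => Ex.
  by eexists; exact: Ex.
have hom_gt3 m (x : gr A) : (3 < m)%N -> gr_homogeneous m x -> x = 0.
  move=> m_gt3 hx; rewrite (hom m x hx) big1 // => i _; rewrite ifN //.
  by apply: contraTneq m_gt3 => <-; case: i => [[|[|[|[|[|?]]]]] ?].
have he1 := he 1%N isT; have he2 := he 2%N isT; have he3 := he 3%N isT.
have M := gr_homogeneousM.
have e11 : e 1%N ** e 1%N = e 2%N := ee 1%N 1%N isT isT.
have e12 : e 1%N ** e 2%N = e 3%N := ee 1%N 2%N isT isT.
have e21 : e 2%N ** e 1%N = e 3%N := ee 2%N 1%N isT isT.
have [ef11 ef12] := ef 1%N isT; have [ef21 ef22] := ef 2%N isT.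
have [ef31 ef32] := ef 3%N isT.
have e3_neq0 : e 3%N != 0.
  by apply: free_not0 (basis_free bX) _; rewrite !inE eqxx !orbT.
have e3Z p : p *: e 3%N = 0 -> p = 0.
  by move/eqP; rewrite scaler_eq0 (negPf e3_neq0) orbF => /eqP.
have [a [b fe1]] := hom2 _ (M _ _ _ _ _ _ hf1 he1).
have [c [d ff1]] := hom2 _ (M _ _ _ _ _ _ hf1 hf1).
have [be fe2] := hom3 _ (M _ _ _ _ _ _ hf2 he1).
have [g ff12] := hom3 _ (M _ _ _ _ _ _ hf1 hf2).
have [de ff21] := hom3 _ (M _ _ _ _ _ _ hf2 hf1).
(* As $e_1 f_1 = 0$, multiplying $f_1 e_1$ and $f_1 f_1$ by $e_1$ on the left gives 0, which kills
   their [e2]-components. *)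
have a0 : a = 0.
  have := amulA (e 1%N) f1 (e 1%N).
  by rewrite ef11 amul0l fe1 amulDr !amulZr e12 ef12 scaler0 addr0 => /e3Z.
have c0 : c = 0.
  have := amulA (e 1%N) f1 f1.
  by rewrite ef11 amul0l ff1 amulDr !amulZr e12 ef12 scaler0 addr0 => /e3Z.
move: fe1 ff1; rewrite a0 c0 !scale0r !add0r => fe1 ff1.
(* Here $e_2 = e_1 e_1$, so the product is $(f_1 e_1) e_1$. *)
have fe12 : f1 ** e 2%N = (b * be) *: e 3%N.
  by rewrite -e11 amulA fe1 amulZl fe2 scalerA.
have fe13 := hom_gt3 4%N _ isT (M _ _ _ _ _ _ hf1 he3).
have fe22 := hom_gt3 4%N _ isT (M _ _ _ _ _ _ hf2 he2).
have fe23 := hom_gt3 5%N _ isT (M _ _ _ _ _ _ hf2 he3).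
have ff22 := hom_gt3 4%N _ isT (M _ _ _ _ _ _ hf2 hf2).
have scX : sc_basis (mu12_sc b d be g de) X.
  split=> //.
  case=> [[|[|[|[|[|?]]]]] ?] [[|[|[|[|[|?]]]]] ?] //;
  rewrite /comb !big_ord_recl big_ord0 !mxE /=
    ?(mulr0, mulr1, scale0r, scale1r, add0r, addr0) ?ee //=;
  by rewrite ?fe1 ?fe12 ?fe13 ?ff1 ?ff12 ?fe2 ?ff21.
exists b, d, be, g, de, (e 1%N), (e 2%N), (e 3%N), f1, f2; split=> //.
(* If both vanished, [f2] would occur in no product, although, having degree 2, it lies in the
   square of [gr A]. *)
apply/norP => -[/negPn/eqP b0 /negPn/eqP d0].
have c4 (i j : 'I_5) :
    mu12_sc b d be g de i.+1 j.+1 0 (Ordinal (isT : 4 < 5)%N) = 0.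
  rewrite b0 d0.
  case: i j => [[|[|[|[|[|?]]]]] ?] [[|[|[|[|[|?]]]]] ?] //=;
  by rewrite !mxE ?mul0r ?mulr0.
have f2sq : f2 \in apow (gr A) 2 by apply: homogeneous2_apow2; rewrite ?dimA.
have := coord_apow2 scX c4 f2sq.
have /= -> := coord_free (Ordinal (isT : 4 < 5)%N) (Ordinal (isT : 4 < 5)%N)
                         (basis_free bX).
by move/eqP; rewrite oner_eq0.
Qed.

(** * Assembling the classification *)

Theorem proposition4p3 (R : realType) :
  (forall A : assocAlgType R[i],
     \dim {:A} = 5%N ->
     nilpotent A ->
     naturally_graded A ->
     two_filiform A ->
     ~ split_alg A ->
     type_mu A 1 2 ->
     alg_iso A (lambda1 R[i]) \/ alg_iso A (lambda2 R[i])) /\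
  ~ alg_iso (lambda1 R[i]) (lambda2 R[i]).
Proof.
split=> [A dimA _ [phi [phi_bij phiM]] filA _ muA|]; last first.
  exact: lambda1_not_iso_lambda2.
have [b [d [be [g [de [e1 [e2 [e3 [f1 [f2 [scX bd]]]]]]]]]]] :=
  type_mu12_sc_basis dimA muA.
(* Natural gradedness provides the isomorphism that moves the table from [gr A] to [A]. *)
have scY : sc_basis (mu12_sc b d be g de)
    [tuple phi e1; phi e2; phi e3; phi f1; phi f2].
  have [bY mY] := sc_basis_iso phi_bij phiM scX.
  by split.
have d0 := mu12_filiform_d0 scY filA.
by apply: (mu12_iso_lambda scY _ d0); move: bd; rewrite d0 eqxx orbF.
Qed.
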